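(* Every Shidoku board is represented by exactly one of the twelve boards $A$–$L$ listed in the context; that is, every orbit of $S_4$ (acting by relabeling) on $\mathcal{S}$ contains exactly one of the boards $A,\dots,L$. The action of $H_4=\langle r,s,t\rangle$ on this set of representatives (equivalently, on the set of $S_4$-orbits) is given on generators by: - $s$: $A\leftrightarrow I$, $B\leftrightarrow G$, $C\leftrightarrow H$, $D\leftrightarrow L$, $E\leftrightarrow J$, $F\leftrightarrow K$; - $t$: $A\leftrightarrow C$, $I\leftrightarrow E$, $H\leftrightarrow D$, $J\leftrightarrow L$, $F\leftrightarrow G$, $B\mapsto B$, $K\mapsto K$; - $r$: $A\leftrightarrow E$, $I\leftrightarrow C$, $H\mapsto D\mapsto J\mapsto L\mapsto H$, $F\leftrightarrow G$, $B\mapsto B$, $K\mapsto K$. Moreover, let $H'$ be a subgroup of $H_4$ and let $X$ be a set of generators of $H'$. Then $H'\times S_4$ is a complete Shidoku symmetry group if and only if the graph with vertex set $\{A,\dots,L\}$ and with an edge joining $P$ and $x\cdot P$ for every $P\in\{A,\dots,L\}$ and $x\in X$ has exactly two connected components.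
   Context: A Shidoku board is a $4\times 4$ array with entries in $\{1,2,3,4\}$ such that each row, each column, and each of the four $2\times 2$ corner blocks (rows $\{1,2\}$ or $\{3,4\}$, columns $\{1,2\}$ or $\{3,4\}$) contains each of $1,2,3,4$ exactly once. Let $\mathcal{S}$ be the set of Shidoku boards; $|\mathcal{S}| = 288$. Number the cells $1,\dots,16$ from left to right and then top to bottom and write a board as $B=(b_1,\dots,b_{16})$. A permutation $x\in S_{16}$ acts on boards by moving the value $b_i$ in cell $i$ to cell $x(i)$. The position symmetry group $H_4\le S_{16}$ is the group of all cell permutations that send every Shidoku board to a Shidoku board. It is generated by $r$ (rotation of the board by a quarter turn clockwise, so the new entry in row $i$, column $j$ is the old entry in row $5-j$, column $i$), $s$ (swap of the third and fourth rows), and $t$ (transpose of the board). The group $S_4$ acts on $\mathcal{S}$ by relabeling: $\sigma\in S_4$ replaces each entry $b_i$ by $\sigma(b_i)$. The two actions commute, and the full Shidoku symmetry group is $G_4=H_4\times S_4$. It has exactly two orbits on $\mathcal{S}$, of sizes $96$ and $192$. A subgroup of $G_4$ is called a complete Shidoku symmetry group if its orbits on $\mathcal{S}$ are exactly the two orbits of $G_4$. The orbits of $S_4$ on $\mathcal{S}$ are called $S_4$-nests. Since the actions commute, $H_4$ acts on the set of $S_4$-nests. The boards $A$–$L$ are, with rows listed from top to bottom and separated by slashes: $A=1234/3412/4123/2341$, $B=1234/3412/2143/4321$, $C=1243/3412/2134/4321$, $D=1243/3421/4132/2314$, $E=1234/3421/2143/4312$, $F=1243/3421/2134/4312$, $G=1234/3412/4321/2143$,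 $H=1243/3412/4321/2134$, $I=1234/3412/2341/4123$, $J=1234/3421/4312/2143$, $K=1243/3421/4312/2134$, $L=1243/3421/2314/4132$. The nest containing each of these boards is denoted by the same letter. For $x\in H_4$ and representatives $P,Q$, the statement $x\cdot P=Q$ (written $P\mapsto Q$) means that $x(P)$ lies in the $S_4$-nest of $Q$, i.e. $\sigma(x(P))=Q$ for some $\sigma\in S_4$; $P\leftrightarrow Q$ means $P\mapsto Q$ and $Q\mapsto P$. *)

(* Defs.v *)
From mathcomp Require Import all_boot all_fingroup.
From mathcomp Require Import zify.

Set Implicit Arguments.
Unset Strict Implicit.
Unset Printing Implicit Defensive.

Import GroupScope.

(* Cells and entries are counted from 0: c : 'I_16 is the cell with
   number c + 1, and the value v : 'I_4 is the entry v + 1. *)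
Definition board : finType := {ffun 'I_16 -> 'I_4}.

Definition row_of (c : 'I_16) : nat := (c %/ 4)%N.
Definition col_of (c : 'I_16) : nat := (c %% 4)%N.
Definition block_of (c : 'I_16) : nat :=
  (2 * (row_of c %/ 2) + col_of c %/ 2)%N.
Definition cell (i j : nat) : 'I_16 := inord (4 * i + j)%N.

Definition once_in (region : 'I_16 -> nat) (B : board) : bool :=
  [forall k : 'I_4, forall v : 'I_4,
     #|[set c : 'I_16 | (region c == k) && (B c == v)]| == 1%N].

Definition shidoku : {set board} :=
  [set B | [&& once_in row_of B, once_in col_of B & once_in block_of B]].

(* The product of permutations in MathComp is (x * y) c = y (x c), so the
   maps below are right actions for this product. *)
Definition pos_act (B : board) (x : 'S_16) : board := [ffun c => B (x^-1 c)].

Lemma pos_actE (B : board) (x : 'S_16) (c : 'I_16) : pos_act B x (x c) = B c.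
Proof. by rewrite ffunE permK. Qed.

Lemma pos_act1 (B : board) : pos_act B 1 = B.
Proof. by apply/ffunP=> c; rewrite ffunE invg1 perm1. Qed.

Lemma pos_actM (B : board) : act_morph pos_act B.
Proof. by move=> x y; apply/ffunP=> c; rewrite !ffunE invMg permM. Qed.

Definition pos_action : {action 'S_16 &-> board} :=
  TotalAction pos_act1 pos_actM.

Definition relabel_act (B : board) (sg : 'S_4) : board := [ffun c => sg (B c)].

Lemma relabel_act1 (B : board) : relabel_act B 1 = B.
Proof. by apply/ffunP=> c; rewrite ffunE perm1. Qed.

Lemma relabel_actM (B : board) : act_morph relabel_act B.
Proof. by move=> x y; apply/ffunP=> c; rewrite !ffunE permM. Qed.

Definition relabel_action : {action 'S_4 &-> board} :=
  TotalAction relabel_act1 relabel_actM.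

Lemma pos_relabelC (B : board) (x : 'S_16) (sg : 'S_4) :
  relabel_act (pos_act B x) sg = pos_act (relabel_act B sg) x.
Proof. by apply/ffunP=> c; rewrite !ffunE. Qed.

Definition sym_act (B : board) (g : 'S_16 * 'S_4) : board :=
  relabel_act (pos_act B g.1) g.2.

Lemma sym_act1 (B : board) : sym_act B 1 = B.
Proof. by rewrite /sym_act pos_act1 relabel_act1. Qed.

Lemma sym_actM (B : board) : act_morph sym_act B.
Proof.
by move=> x y; rewrite /sym_act pos_actM relabel_actM pos_relabelC.
Qed.

Definition sym_action : {action ('S_16 * 'S_4)%type &-> board} :=
  TotalAction sym_act1 sym_actM.

(* The cell permutations sending every Shidoku board to a Shidoku board. *)
Definition H4 : {group 'S_16} := 'N(shidoku | pos_action)%G.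

Definition G4 : {group 'S_16 * 'S_4} := setX_group H4 [set: 'S_4]%G.

Definition complete_symmetry_group (K : {group 'S_16 * 'S_4}) : Prop :=
  K \subset G4 /\
  orbit sym_action K @: shidoku = orbit sym_action G4 @: shidoku.

(* Clockwise quarter turn: the entry in row i, column j (from 0) moves to row
   j, column 3 - i. *)
Definition rot_fun (c : 'I_16) : 'I_16 := cell (col_of c) (3 - row_of c)%N.
Definition swap_fun (c : 'I_16) : 'I_16 :=
  cell (if row_of c == 2 then 3 else if row_of c == 3 then 2 else row_of c)%N
       (col_of c).
Definition transpose_fun (c : 'I_16) : 'I_16 := cell (col_of c) (row_of c).

Lemma cell_inj (i j k l : nat) :
  (i < 4)%N -> (j < 4)%N -> (k < 4)%N -> (l < 4)%N ->
  cell i j = cell k l -> i = k /\ j = l.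
Proof.
move=> i4 j4 k4 l4 /(congr1 val).
by rewrite /cell /= !inordK; lia.
Qed.

Lemma row_lt4 (c : 'I_16) : (row_of c < 4)%N.
Proof. by rewrite /row_of ltn_divLR. Qed.

Lemma col_lt4 (c : 'I_16) : (col_of c < 4)%N.
Proof. by rewrite /col_of ltn_mod. Qed.

Lemma row_col_inj (c d : 'I_16) :
  row_of c = row_of d -> col_of c = col_of d -> c = d.
Proof.
rewrite /row_of /col_of => er ec; apply: val_inj => /=.
by rewrite (divn_eq c 4) er ec -divn_eq.
Qed.

Lemma rot_inj : injective rot_fun.
Proof.
move=> c d /cell_inj; rewrite !col_lt4 !ltnS !leq_subr.
case=> // ec /eqP er; apply: row_col_inj => //.
by have := row_lt4 c; have := row_lt4 d; lia.
Qed.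

Lemma swap_inj : injective swap_fun.
Proof.
move=> c d; have rc := row_lt4 c; have rd := row_lt4 d.
case/cell_inj; rewrite ?col_lt4 //; try by do 2?case: ifP.
move=> er ec; apply: row_col_inj => //.
by move: rc rd er; case: (row_of c) (row_of d) => [|[|[|[|?]]]] [|[|[|[|?]]]].
Qed.

Lemma transpose_inj : injective transpose_fun.
Proof.
move=> c d; case/cell_inj; rewrite ?row_lt4 ?col_lt4 // => *.
exact: row_col_inj.
Qed.

Definition r : 'S_16 := perm rot_inj.
Definition s : 'S_16 := perm swap_inj.
Definition t : 'S_16 := perm transpose_inj.

Definition nest (B : board) : {set board} :=
  orbit relabel_action [set: 'S_4] B.
Definition nests : {set {set board}} := nest @: shidoku.

Definition board_of (digits : seq nat) : board :=
  [ffun c : 'I_16 => inord (nth 0%N digits c).-1].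

Definition board_A := board_of [:: 1;2;3;4; 3;4;1;2; 4;1;2;3; 2;3;4;1]%N.
Definition board_B := board_of [:: 1;2;3;4; 3;4;1;2; 2;1;4;3; 4;3;2;1]%N.
Definition board_C := board_of [:: 1;2;4;3; 3;4;1;2; 2;1;3;4; 4;3;2;1]%N.
Definition board_D := board_of [:: 1;2;4;3; 3;4;2;1; 4;1;3;2; 2;3;1;4]%N.
Definition board_E := board_of [:: 1;2;3;4; 3;4;2;1; 2;1;4;3; 4;3;1;2]%N.
Definition board_F := board_of [:: 1;2;4;3; 3;4;2;1; 2;1;3;4; 4;3;1;2]%N.
Definition board_G := board_of [:: 1;2;3;4; 3;4;1;2; 4;3;2;1; 2;1;4;3]%N.
Definition board_H := board_of [:: 1;2;4;3; 3;4;1;2; 4;3;2;1; 2;1;3;4]%N.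
Definition board_I := board_of [:: 1;2;3;4; 3;4;1;2; 2;3;4;1; 4;1;2;3]%N.
Definition board_J := board_of [:: 1;2;3;4; 3;4;2;1; 4;3;1;2; 2;1;4;3]%N.
Definition board_K := board_of [:: 1;2;4;3; 3;4;2;1; 4;3;1;2; 2;1;3;4]%N.
Definition board_L := board_of [:: 1;2;4;3; 3;4;2;1; 2;3;1;4; 4;1;3;2]%N.

Definition reps : {set board} :=
  [set B in [:: board_A; board_B; board_C; board_D; board_E; board_F;
                board_G; board_H; board_I; board_J; board_K; board_L]].

Definition maps_to (x : 'S_16) (P Q : board) : bool :=
  pos_act P x \in nest Q.

Definition swaps (x : 'S_16) (P Q : board) : bool :=
  maps_to x P Q && maps_to x Q P.

(* Undirected: Q is the representative x.P, or P is the representative x.Q,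
   for some x in X. *)
Definition nest_graph (X : {set 'S_16}) : rel board := fun P Q =>
  [&& P \in reps, Q \in reps & [exists x in X, maps_to x P Q || maps_to x Q P]].

(* n_comp counts components correctly only for a symmetric connectivity
   relation and a closed vertex set; both hold here. *)
Lemma nest_graph_sym (X : {set 'S_16}) : symmetric (nest_graph X).
Proof.
move=> P Q; rewrite /nest_graph andbCA; do 2!congr (_ && _).
by apply: eq_existsb => x; rewrite orbC.
Qed.

Lemma nest_graph_connect_sym (X : {set 'S_16}) : connect_sym (nest_graph X).
Proof. exact/sym_connect_sym/nest_graph_sym. Qed.

Lemma nest_graph_closed (X : {set 'S_16}) : closed (nest_graph X) reps.
Proof. by move=> P Q /and3P[-> ->]. Qed.

Definition component_count (X : {set 'S_16}) : nat := n_comp (nest_graph X) reps.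

(* Main.v *)
(* Two cells are called adjacent when they are distinct and share a row, a
   column or a block; a board is a Shidoku board iff it separates adjacent
   cells.  Relabeling turns the top left block into 12/34 in a unique way, and
   exactly twelve Shidoku boards have that block, namely A - L.  Each pair of
   non-adjacent cells carries equal entries in one of these twelve boards, so
   the elements of H_4 are exactly the automorphisms of the adjacency graph; a
   backtracking search finds 128 of them, and each is a word in r, s, t.

   For the criterion, P and Q lie in the same component of the graph of X iff
   they lie in the same orbit of H' x S_4, so the components are counted by the
   orbits.  The orbits of H' x S_4 refine those of G_4, of which there are two,
   so they coincide as soon as there are also two of them. *)
Require Import Defs.
From mathcomp Require Import all_boot all_fingroup.
From mathcomp Require Import zify.

Set Implicit Arguments.
Unset Strict Implicit.
Unset Printing Implicit Defensive.

Import GroupScope.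

(** * Exhaustive search over finite tables *)

(* For j = k the default value b of nth is read, so R k b k b restricts single
   entries. *)
Fixpoint search (R : nat -> nat -> nat -> nat -> bool) (m n : nat) :
    seq (seq nat) :=
  if n is k.+1 then
    [seq rcons l b | l <- search R m k,
       b <- [seq b <- iota 0 m | all (fun j => R j (nth b l j) k b) (iota 0 n)]]
  else [:: [::]].

(** The prefix of length [n] is found by induction and [f n] passes the filter. Hence a check over
    the computed list proves a fact about every admissible [f]. *)
Lemma mem_search (R : nat -> nat -> nat -> nat -> bool) m n (f : nat -> nat) :
  (forall i, i < n -> f i < m)%N ->
  (forall j k, j <= k < n -> R j (f j) k (f k))%N ->
  mkseq f n \in search R m n.
Proof.
elim: n => [|n IHn] fm fR //.
apply/allpairsPdep; exists (mkseq f n), (f n); split.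
- apply: IHn => [i ilt|j k jk]; [apply: fm | apply: fR]; lia.
- rewrite mem_filter mem_iota leq0n add0n fm // !andbT; apply/allP => j.
  rewrite mem_iota add0n ltnS /= => jn.
  have -> : nth (f n) (mkseq f n) j = f j.
    move: jn; rewrite leq_eqVlt => /predU1P[->|jn]; last by rewrite nth_mkseq.
    by rewrite nth_default ?size_mkseq.
  by apply: fR; lia.
- by rewrite /mkseq -[in LHS]addn1 iotaD map_cat cats1.
Qed.

(** Functions on cells become lists of natural numbers, on which the finite checks are evaluated. *)
Definition vals m (f : 'I_16 -> 'I_m) : seq nat :=
  mkseq (fun i => f (inord i) : nat) 16.

Lemma nth_vals m (f : 'I_16 -> 'I_m) (c : 'I_16) : nth 0%N (vals f) c = f c.
Proof. by rewrite nth_mkseq // inord_val. Qed.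

Lemma all_ord n (p : pred nat) : all p (iota 0 n) -> forall c : 'I_n, p c.
Proof. by move=> /allP pP c; apply: pP; rewrite mem_iota ltn_ord. Qed.

Lemma all_ord2 n (p : nat -> nat -> bool) :
  all (fun i => all (p i) (iota 0 n)) (iota 0 n) -> forall c d : 'I_n, p c d.
Proof. by move=> /all_ord pP c d; apply: (@all_ord n (p c)). Qed.

(** * Adjacency of cells *)

Definition block_nat (i : nat) : nat := (2 * (i %/ 4 %/ 2) + i %% 4 %/ 2)%N.

Definition adj (i j : nat) : bool :=
  (i != j) && [|| i %/ 4 == j %/ 4, i %% 4 == j %% 4 |
    block_nat i == block_nat j]%N.

(** A region has four cells and there are four values, so being injective on it amounts to taking
    each value exactly once. *)
Lemma once_inP (region : nat -> nat) (B : board) :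
  all (fun i => region i < 4)%N (iota 0 16) ->
  all (fun k => count (fun i => region i == k) (iota 0 16) == 4) (iota 0 4) ->
  reflect (forall c d : 'I_16, region c = region d -> B c = B d -> c = d)
          (once_in region B).
Proof.
move=> /all_ord lt4 /allP count4; apply: (iffP forallP) => [once c d rcd Bcd|inj k].
  have /forallP/(_ (B c))/cards1P[e eP] := once (Ordinal (lt4 c)).
  have : c \in [set e] by rewrite -eP inE /= !eqxx.
  have : d \in [set e] by rewrite -eP inE /= rcd Bcd !eqxx.
  by rewrite !inE => /eqP-> /eqP->.
apply/forallP => v.
have cardk : #|[set c : 'I_16 | region c == k]| = 4.
  apply: etrans (eqP (count4 k _)); last by rewrite mem_iota ltn_ord.
  rewrite cardsE cardE /enum_mem size_filter -enumT -val_enum_ord count_map.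
  exact: eq_count.
have injk : {in [set c : 'I_16 | region c == k] &, injective B}.
  by move=> c d; rewrite !inE => /eqP rc /eqP rd; apply: inj; rewrite rc rd.
have /setP/(_ v) : B @: [set c : 'I_16 | region c == k] = setT.
  by apply/eqP; rewrite eqEcard subsetT cardsT card_ord card_in_imset // cardk.
rewrite inE => /imsetP[c]; rewrite inE => /eqP rc ->.
apply/cards1P; exists c; apply/setP => d; rewrite !inE.
apply/andP/eqP => [[/eqP rd /eqP Bd]|-> ]; last by rewrite rc !eqxx.
by apply: inj => //; rewrite rd rc.
Qed.

Lemma shidokuP (B : board) :
  reflect (forall c d : 'I_16, adj c d -> B c != B d) (B \in shidoku).
Proof.
rewrite inE; apply: (iffP and3P) => [[]|ok].
  move=> /(@once_inP (fun i => i %/ 4)%N _ isT isT) row.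
  move=> /(@once_inP (fun i => i %% 4)%N _ isT isT) col.
  move=> /(@once_inP block_nat _ isT isT) blk c d.
  case/andP => /eqP ncd reg; apply/eqP => Bcd; apply: ncd; congr val.
  case/or3P: reg => /eqP reg; [exact: row | exact: col | exact: blk].
have reg (region : nat -> nat) :
    (forall i j : nat, i != j -> region i = region j -> adj i j) ->
    forall c d : 'I_16, region c = region d -> B c = B d -> c = d.
  move=> radj c d rcd Bcd; apply/eqP/negPn/negP => ncd.
  by have /negP[] := ok c d (radj _ _ ncd rcd); rewrite Bcd.
split.
- apply/(@once_inP (fun i => i %/ 4)%N _ isT isT).
  apply: (reg (fun i => i %/ 4)%N) => i j nij e.
  by rewrite /adj nij e eqxx.
- apply/(@once_inP (fun i => i %% 4)%N _ isT isT).
  apply: (reg (fun i => i %% 4)%N) => i j nij e.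
  by rewrite /adj nij e eqxx orbT.
apply/(@once_inP block_nat _ isT isT).
by apply: (reg block_nat) => i j nij e; rewrite /adj nij e eqxx !orbT.
Qed.

(** * The twelve representatives *)

Definition rep_digits : seq (seq nat) :=
  [:: [:: 1;2;3;4; 3;4;1;2; 4;1;2;3; 2;3;4;1];
      [:: 1;2;3;4; 3;4;1;2; 2;1;4;3; 4;3;2;1];
      [:: 1;2;4;3; 3;4;1;2; 2;1;3;4; 4;3;2;1];
      [:: 1;2;4;3; 3;4;2;1; 4;1;3;2; 2;3;1;4];
      [:: 1;2;3;4; 3;4;2;1; 2;1;4;3; 4;3;1;2];
      [:: 1;2;4;3; 3;4;2;1; 2;1;3;4; 4;3;1;2];
      [:: 1;2;3;4; 3;4;1;2; 4;3;2;1; 2;1;4;3];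
      [:: 1;2;4;3; 3;4;1;2; 4;3;2;1; 2;1;3;4];
      [:: 1;2;3;4; 3;4;1;2; 2;3;4;1; 4;1;2;3];
      [:: 1;2;3;4; 3;4;2;1; 4;3;1;2; 2;1;4;3];
      [:: 1;2;4;3; 3;4;2;1; 4;3;1;2; 2;1;3;4];
      [:: 1;2;4;3; 3;4;2;1; 2;3;1;4; 4;1;3;2]]%N.

Lemma repsE : reps = [set B in map board_of rep_digits].
Proof. by []. Qed.

Lemma repsP (P : board) :
  reflect (exists2 d, d \in rep_digits & P = board_of d) (P \in reps).
Proof. by rewrite repsE inE; apply: mapP. Qed.

Lemma val_board_of (d : seq nat) (c : 'I_16) :
  all (fun v => v.-1 < 4)%N d -> board_of d c = (nth 0%N d c).-1 :> nat.
Proof.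
move=> /allP d4; rewrite ffunE inordK //.
(* Past the end of [d] the default 0 is read, and its predecessor is again 0. *)
have [/(mem_nth 0%N)/d4 //|/(nth_default 0%N)-> //] := ltnP c (size d).
Qed.

Lemma val_rep (d : seq nat) (c : 'I_16) :
  d \in rep_digits -> board_of d c = (nth 0%N d c).-1 :> nat.
Proof.
move=> dR; apply: val_board_of.
by have /allP/(_ d dR) : all (all (fun v => v.-1 < 4)%N) rep_digits by [].
Qed.

Lemma reps_shidoku (P : board) : P \in reps -> P \in shidoku.
Proof.
case/repsP=> d dR ->; apply/shidokuP => c e; apply/implyP.
rewrite -val_eqE /= !val_rep //; move: c e.
apply: (@all_ord2 16 (fun i j => adj i j ==> ((nth 0 d i).-1 != (nth 0 d j).-1)%N)).
by move: d dR; apply/allP; vm_compute.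
Qed.

(** The top left block in reading order: it reads 12/34 when each [corner v] holds [v]. *)
Definition corner (v : 'I_4) : 'I_16 := inord (nth 0%N [:: 0; 1; 4; 5]%N v).

Lemma val_corner v : corner v = nth 0%N [:: 0; 1; 4; 5]%N v :> nat.
Proof. by rewrite inordK //; case: v => [[|[|[|[|]]]]]. Qed.

Lemma rep_corner (P : board) (v : 'I_4) : P \in reps -> P (corner v) = v.
Proof.
case/repsP=> d dR ->; apply: val_inj; rewrite /= val_rep // val_corner.
apply/eqP; move: v; pose cs := [:: 0; 1; 4; 5]%N.
apply: (@all_ord 4 (fun i => (nth 0 d (nth 0 cs i)).-1 == i)%N).
by move: d dR; apply/allP.
Qed.

Lemma nestP (P B : board) :
  reflect (exists sg : 'S_4, B = relabel_act P sg) (B \in nest P).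
Proof.
rewrite /nest; apply: (iffP orbitP) => [[sg _ <-]|[sg ->]]; first by exists sg.
by exists sg.
Qed.

Lemma relabel_shidoku (B : board) (sg : 'S_4) :
  B \in shidoku -> relabel_act B sg \in shidoku.
Proof.
move=> /shidokuP ok; apply/shidokuP => c d cd.
by rewrite !ffunE (inj_eq perm_inj) ok.
Qed.

Lemma normal_in_reps (B : board) :
  B \in shidoku -> (forall v, B (corner v) = v) -> B \in reps.
Proof.
move=> /shidokuP ok Bcorner.
(* The first condition separates adjacent cells; the second prescribes the entries of the top left
   block. *)
pose R j a k b := (adj j k ==> (a != b)) &&
  ((k \in [:: 0; 1; 4; 5]) ==> (b == index k [:: 0; 1; 4; 5]))%N.
have: vals (fun c => B c) \in search R 4 16.
  apply: mem_search => [i _|j k /andP[jk k16]]; first exact: ltn_ord.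
  have j16 : (j < 16)%N by lia.
  apply/andP; split; apply/implyP => h.
    by have := ok (inord j) (inord k); rewrite !inordK //; apply.
  have v4 : (index k [:: 0; 1; 4; 5] < 4)%N by rewrite index_mem.
  rewrite -{1}(nth_index 0%N h); apply/eqP.
  exact: (congr1 val (Bcorner (Ordinal v4))).
have /allP sub : all [in map (map predn) rep_digits] (search R 4 16).
  by vm_compute.
case/sub/mapP=> d dR eB; apply/repsP; exists d => //.
apply/ffunP => c; apply: val_inj; rewrite /= val_rep // -(nth_vals (fun c => B c)) eB.
have [cd|dc] := ltnP c (size d); first exact: nth_map.
by rewrite !nth_default ?size_map.
Qed.

(** The corner cells are pairwise adjacent, so their entries form a permutation; relabeling by its
    inverse normalizes the block. *)
Lemma rep_exists (B : board) :
  B \in shidoku -> exists2 P, P \in reps & B \in nest P.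
Proof.
move=> Bsh; have inj : injective (fun v => B (corner v)).
  move=> v w /eqP e; apply: contraTeq e => nvw.
  have /shidokuP := Bsh; apply; rewrite !val_corner.
  apply: (implyP _ nvw); move: v w {nvw}.
  pose cs := [:: 0; 1; 4; 5]%N.
  exact: (@all_ord2 4 (fun i j => (i != j) ==> adj (nth 0 cs i) (nth 0 cs j))%N).
exists (relabel_act B (perm inj)^-1).
  apply: normal_in_reps; first exact: relabel_shidoku.
  by move=> v; rewrite ffunE -[RHS](permK (perm inj)) permE.
by apply/nestP; exists (perm inj); rewrite -relabel_actM mulVg relabel_act1.
Qed.

(** Both representatives have the same corner entries, which forces the two relabelings to agree. *)
Lemma rep_uniq (P Q B : board) :
  P \in reps -> Q \in reps -> B \in nest P -> B \in nest Q -> P = Q.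
Proof.
move=> PR QR /nestP[sg ->] /nestP[tau /ffunP e].
have {}e c : sg (P c) = tau (Q c) by have := e c; rewrite !ffunE.
have sg_tau : sg = tau.
  by apply/permP => v; have := e (corner v); rewrite !rep_corner.
by apply/ffunP => c; have := e c; rewrite sg_tau => /perm_inj.
Qed.

Lemma nest_refl (P : board) : P \in nest P.
Proof. exact: orbit_refl. Qed.

Lemma board_of_inj : {in rep_digits &, injective board_of}.
Proof.
move=> d e dR eR /ffunP de.
have sz f : f \in rep_digits -> size f == 16 by move: f; apply/allP.
(* The shift [.-1] identifies 0 and 1, so digits can be recovered from entries only because they are
   positive. *)
have pos f (c : 'I_16) : f \in rep_digits -> (0 < nth 0 f c)%N.
  move=> fR; move: c; apply: (@all_ord 16 (fun i => 0 < nth 0 f i)%N).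
  by move: f fR; apply/allP.
apply: (@eq_from_nth _ 0%N) => [|i]; first by rewrite (eqP (sz d dR)) (eqP (sz e eR)).
rewrite (eqP (sz d dR)) => i16.
have := congr1 val (de (Ordinal i16)); rewrite /= !val_rep //=.
by have := pos d (Ordinal i16) dR; have := pos e (Ordinal i16) eR => /=; lia.
Qed.

Lemma card_reps : #|reps| = 12%N.
Proof.
rewrite repsE cardsE; apply/(@card_uniqP _ (map board_of rep_digits)).
by rewrite (map_inj_in_uniq board_of_inj).
Qed.

Lemma mem_astabs (aT : finGroupType) (T : finType) (to : {action aT &-> T})
    (S : {set T}) (x : aT) :
  (forall B, B \in S -> to B x \in S) -> x \in 'N(S | to).
Proof. by move=> xS; rewrite !inE; apply/subsetP => B BS; rewrite inE xS. Qed.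

Lemma reps_transversal : is_transversal reps nests shidoku.
Proof.
apply/and3P; split.
- apply: orbit_partition; apply/subsetP => sg _.
  by apply: mem_astabs => B; apply: relabel_shidoku.
- by apply/subsetP => P; apply: reps_shidoku.
apply/forall_inP => N /imsetP[B /rep_exists[P PR BP] ->].
have eN : nest B = nest P by apply/orbit_eqP.
apply/cards1P; exists P; apply/setP => Q; rewrite in_setI in_set1 eN.
apply/andP/eqP => [[QR QP]|->]; last by rewrite nest_refl.
exact: (rep_uniq QR PR (nest_refl Q) QP).
Qed.

(** * Position symmetries as graph automorphisms *)

Lemma pos_act_shidoku (x : 'S_16) (B : board) :
  x \in H4 -> (pos_act B x \in shidoku) = (B \in shidoku).
Proof. by move=> xH; apply: (astabs_act B xH). Qed.

Lemma nonadj_rep (c d : 'I_16) :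
  ~~ adj c d -> exists2 P : board, P \in reps & P c = P d.
Proof.
pose eqv i j e := (nth 0 e i == nth 0 e j)%N.
have : adj c d || has (eqv c d) rep_digits.
  by apply: (@all_ord2 16 (fun i j => adj i j || has (eqv i j) rep_digits)); vm_compute.
case/orP=> [->//|/hasP[e eR /eqP ecd] _].
exists (board_of e); first by apply/repsP; exists e.
by apply: val_inj; rewrite /= !val_rep // ecd.
Qed.

(** If adjacent cells had non-adjacent images, a representative with equal entries at the images
    would pull back to a Shidoku board with equal entries at adjacent cells. The inverse gives the
    other direction. *)
Lemma adj_H4 (x : 'S_16) (c d : 'I_16) : x \in H4 -> adj (x c) (x d) = adj c d.
Proof.
have imp y (e f : 'I_16) : y \in H4 -> adj e f -> adj (y e) (y f).
  move=> yH ef; apply: contraTT yH => /nonadj_rep[P PR Pef].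
  apply: contraTN ef => yH; apply/negP => ef.
  have: pos_act P y^-1 \in shidoku by rewrite pos_act_shidoku ?groupV ?reps_shidoku.
  by move=> /shidokuP/(_ _ _ ef); rewrite !ffunE invgK Pef eqxx.
move=> xH; apply/idP/idP; last exact: imp.
by move=> /(imp _ _ _ (groupVr xH)); rewrite !permK.
Qed.

Lemma mem_H4 (x : 'S_16) :
  (forall c d : 'I_16, adj (x c) (x d) -> adj c d) -> x \in H4.
Proof.
move=> xadj; apply: mem_astabs => B /shidokuP ok.
by apply/shidokuP => c d cd; rewrite !ffunE ok // xadj // !permKV.
Qed.

(** * Generation by the three symmetries *)

Definition rot_nat (i : nat) : nat := (4 * (i %% 4) + (3 - i %/ 4))%N.
Definition swap_nat (i : nat) : nat :=
  (4 * (if i %/ 4 == 2 then 3 else if i %/ 4 == 3 then 2 else i %/ 4) + i %% 4)%N.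
Definition transpose_nat (i : nat) : nat := (4 * (i %% 4) + i %/ 4)%N.

Lemma val_cell (i j : nat) : (i < 4 -> j < 4 -> cell i j = 4 * i + j :> nat)%N.
Proof. by move=> i4 j4; rewrite inordK //; lia. Qed.

Lemma val_r (c : 'I_16) : r c = rot_nat c :> nat.
Proof. by rewrite permE val_cell ?col_lt4 // ltnS leq_subr. Qed.

Lemma val_s (c : 'I_16) : s c = swap_nat c :> nat.
Proof.
by rewrite permE val_cell ?col_lt4 //; do 2?[case: ifP => //];
  rewrite row_lt4.
Qed.

Lemma val_t (c : 'I_16) : t c = transpose_nat c :> nat.
Proof. by rewrite permE val_cell ?col_lt4 ?row_lt4. Qed.

(** Here [t] is the default of [nth], so every number from 2 on codes [t] and every number is a
    letter. *)
Definition letter (k : nat) : 'S_16 := nth t [:: r; s] k.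
Definition letter_nat (k : nat) : nat -> nat :=
  nth transpose_nat [:: rot_nat; swap_nat] k.

Lemma val_letter k (c : 'I_16) : letter k c = letter_nat k c :> nat.
Proof.
by case: k => [|[|k]];
  rewrite /letter /letter_nat /= ?nth_nil ?val_r ?val_s ?val_t.
Qed.

Definition word (w : seq nat) : 'S_16 := \prod_(k <- w) letter k.
(** A product of permutations applies its left factor first, hence a left fold. *)
Definition word_nat (w : seq nat) (i : nat) : nat :=
  foldl (fun j k => letter_nat k j) i w.

Lemma val_word w (c : 'I_16) : word w c = word_nat w c :> nat.
Proof.
rewrite /word; elim: w c => [|k w IHw] c; first by rewrite big_nil perm1.
by rewrite big_cons permM IHw val_letter.
Qed.

Lemma letter_gen k : letter k \in <<[set r; s; t]>>.
Proof.
apply: mem_gen; rewrite !inE.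
by case: k => [|[|k]]; rewrite /letter /= ?nth_nil eqxx ?orbT.
Qed.

(* A product of some of the four swaps of adjacent rows or columns within a
   band, followed by one of the eight symmetries of the square. *)
Definition words : seq (seq nat) :=
  foldr (fun L acc => [seq a ++ b | a <- L, b <- acc]) [:: [::]]
    [:: [:: [::]; [:: 1]]; [:: [::]; [:: 0; 1; 0; 0; 0]];
        [:: [::]; [:: 0; 0; 1; 0; 0]]; [:: [::]; [:: 0; 0; 0; 1; 0]];
        [:: [::]; [:: 0]; [:: 0; 0]; [:: 0; 0; 0]]; [:: [::]; [:: 2]]]%N.

Lemma H4_gen : H4 = <<[set r; s; t]>> :> {set 'S_16}.
Proof.
apply/eqP; rewrite eqEsubset; apply/andP; split; last first.
  have letter_H4 k : all (fun i => all (fun j =>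
      adj (letter_nat k i) (letter_nat k j) ==> adj i j) (iota 0 16)) (iota 0 16) ->
      letter k \in H4.
    move=> /all_ord2 ok; apply: mem_H4 => c d.
    by rewrite !val_letter; apply/implyP.
  rewrite gen_subG; apply/subsetP => x; rewrite !in_setU !in_set1.
  by case/orP=> [/orP[]|] /eqP->;
    [apply: (letter_H4 0%N) | apply: (letter_H4 1%N) | apply: (letter_H4 2%N)];
    vm_compute.
apply/subsetP => x xH.
(* The first disjunct disposes of [j = k]; the second asks for injectivity and preservation of
   adjacency in both directions. *)
pose R j a k b := (j == k) || ((adj j k == adj a b) && (a != b)).
have: vals x \in search R 16 16.
  apply: (@mem_search R 16 16 (fun i => x (inord i) : nat)) => [i _|j k /andP[jk k16]].
    exact: ltn_ord.
  rewrite /R; have [//|njk] := eqVneq j k; have j16 : (j < 16)%N by lia.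
  have := adj_H4 (inord j) (inord k) xH; rewrite !inordK // => ->.
  rewrite eqxx /= val_eqE (inj_eq perm_inj); apply: contraNneq njk.
  by move=> /(congr1 val); rewrite /= !inordK // => ->.
(* With the word tables passed as an argument, [vm_compute] builds them once rather than at each
   membership test. *)
pose autos_in (S : seq (seq nat)) := all [in S] (search R 16 16).
have /allP sub : autos_in [seq mkseq (word_nat w) 16 | w <- words] by vm_compute.
case/sub/mapP=> w _ eqx.
suff -> : x = word w by apply: group_prod => k _; apply: letter_gen.
apply/permP => c; apply: val_inj.
by rewrite /= val_word -(nth_vals x) eqx nth_mkseq.
Qed.

(** * Moves of the representatives under the generators *)

(** Boards with the same partition of cells into equal entries differ by a relabeling, here read off
    at the corner cells. *)
Lemma maps_to_pattern (x : 'S_16) (P Q : board) :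
  Q \in reps -> (forall c d : 'I_16, P c = P d <-> Q (x c) = Q (x d)) ->
  maps_to x P Q.
Proof.
move=> QR pat.
have inj : injective (fun v : 'I_4 => P (x^-1 (corner v))).
  by move=> v w /= e; have := (pat _ _).1 e; rewrite !permKV !rep_corner.
apply/nestP; exists (perm inj); apply/ffunP => c; rewrite !ffunE (permE inj).
by apply: (pat _ _).2; rewrite !permKV rep_corner.
Qed.

Lemma maps_to_digits k (d e : seq nat) :
  d \in rep_digits -> e \in rep_digits ->
  all (fun i => all (fun j => ((nth 0 d i).-1 == (nth 0 d j).-1) ==
      ((nth 0 e (letter_nat k i)).-1 == (nth 0 e (letter_nat k j)).-1)) (iota 0 16))
    (iota 0 16)%N ->
  maps_to (letter k) (board_of d) (board_of e).
Proof.
move=> dR eR /all_ord2 pat; apply: maps_to_pattern; first by apply/repsP; exists e.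
move=> c f; have /eqP := pat c f.
rewrite -!val_letter -!val_rep // => e_eq.
by split=> /(congr1 val)/eqP h; apply: val_inj; apply/eqP; move: h; rewrite /= e_eq.
Qed.

Ltac maps_to_tac k := apply: (@maps_to_digits k); vm_compute; reflexivity.

Lemma generator_moves :
  [/\ [/\ swaps s board_A board_I, swaps s board_B board_G
        & swaps s board_C board_H] /\
      [/\ swaps s board_D board_L, swaps s board_E board_J
        & swaps s board_F board_K],
      [/\ swaps t board_A board_C, swaps t board_I board_E,
          swaps t board_H board_D & swaps t board_J board_L] /\
      [/\ swaps t board_F board_G, maps_to t board_B board_B
        & maps_to t board_K board_K]
    & [/\ swaps r board_A board_E & swaps r board_I board_C] /\
      [/\ maps_to r board_H board_D, maps_to r board_D board_J,
          maps_to r board_J board_L & maps_to r board_L board_H] /\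
      [/\ swaps r board_F board_G, maps_to r board_B board_B
        & maps_to r board_K board_K]].
Proof.
by do !split; try (apply/andP; split);
  first [maps_to_tac 0%N | maps_to_tac 1%N | maps_to_tac 2%N].
Qed.

(** * Graph components and orbits *)

Lemma nest_relabel (P B : board) (sg : 'S_4) :
  B \in nest P -> relabel_act B sg \in nest P.
Proof.
by move=> /nestP[tau ->]; apply/nestP; exists (tau * sg); rewrite relabel_actM.
Qed.

Lemma nest_sub_orbit (H' : {group 'S_16}) (P B : board) :
  B \in nest P -> B \in orbit sym_action (setX_group H' [set: 'S_4]%G) P.
Proof.
move=> /nestP[sg ->]; apply/orbitP; exists (1, sg).
  by rewrite in_setX group1 in_setT.
by rewrite /= /sym_act pos_act1.
Qed.

Lemma maps_to_orbit (H' : {group 'S_16}) (x : 'S_16) (P Q : board) :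
  x \in H' -> maps_to x P Q ->
  Q \in orbit sym_action (setX_group H' [set: 'S_4]%G) P.
Proof.
move=> xH /nestP[sg e]; apply/orbitP; exists (x, sg^-1).
  by rewrite in_setX xH in_setT.
by rewrite /= /sym_act /= e -relabel_actM mulgV relabel_act1.
Qed.

(** The union of the nests of [D] is stable under relabeling and under each generator in [X], hence
    under all of [H']. This confines an orbit to a few nests. *)
Lemma orbit_closed (H' : {group 'S_16}) (X : {set 'S_16}) (D : {set board})
    (P B : board) :
  X \subset H4 -> <<X>> = H' -> D \subset reps ->
  (forall x P Q, x \in X -> P \in D -> Q \in reps -> maps_to x P Q -> Q \in D) ->
  P \in D -> B \in orbit sym_action (setX_group H' [set: 'S_4]%G) P ->
  exists2 Q, Q \in D & B \in nest Q.
Proof.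
move=> XH4 genX Dreps Dclosed PD.
pose C : {set board} := \bigcup_(Q in D) nest Q.
have C_stable : H' \subset 'N(C | pos_action).
  rewrite -genX gen_subG; apply/subsetP => x xX; apply: mem_astabs => B'.
  move=> /bigcupP[Q QD /nestP[sg ->]]; rewrite /= -pos_relabelC.
  have Qsh : pos_act Q x \in shidoku.
    by rewrite pos_act_shidoku ?(subsetP XH4) ?reps_shidoku ?(subsetP Dreps).
  have [Q' Q'R QQ'] := rep_exists Qsh.
  apply/bigcupP; exists Q'; last exact: nest_relabel.
  exact: Dclosed xX QD Q'R QQ'.
move=> /orbitP[[x sg]]; rewrite in_setX => /andP[xH _] <-.
have PC : P \in C by apply/bigcupP; exists P => //; apply: nest_refl.
have : pos_act P x \in C by rewrite -(astabs_act P (subsetP C_stable x xH)) in PC.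
by move=> /bigcupP[Q QD PQ]; exists Q => //; apply: nest_relabel.
Qed.

Lemma connect_orbit (H' : {group 'S_16}) (X : {set 'S_16}) (P Q : board) :
  X \subset H4 -> <<X>> = H' -> P \in reps -> Q \in reps ->
  connect (nest_graph X) P Q =
    (Q \in orbit sym_action (setX_group H' [set: 'S_4]%G) P).
Proof.
move=> XH4 genX PR QR; set K := setX_group _ _.
have XH' x : x \in X -> x \in H' by rewrite -genX => /mem_gen.
apply/idP/idP => [PQ|].
  (* An edge never leaves an orbit, so neither does a path. *)
  have orbit_nest_closed : closed (nest_graph X) (orbit sym_action K P).
    move=> Y Z /and3P[_ _ /existsP[x /andP[/XH' xH YZ]]].
    rewrite -!(orbit_sym _ _ P); suff /orbit_eqP-> : Y \in orbit sym_action K Z by [].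
    by case/orP: YZ => /(maps_to_orbit xH); rewrite // orbit_sym.
  by rewrite -(closed_connect orbit_nest_closed PQ) orbit_refl.
(* Conversely, the component of [P] is closed under the moves of [X], so its nests contain the whole
   orbit. *)
pose D := [set R in reps | connect (nest_graph X) P R].
have PD : P \in D by apply/setIdP; rewrite connect0.
have Dreps : D \subset reps by apply/subsetP => R /setIdP[].
move=> /(orbit_closed XH4 genX Dreps _ PD)[x Y Z xX|R].
  move=> /setIdP[YR PY] ZR YZ; apply/setIdP; split=> //.
  apply: connect_trans PY (connect1 _).
  by rewrite /nest_graph YR ZR; apply/existsP; exists x; rewrite xX YZ.
move=> /setIdP[RR PR'] QinR.
by rewrite (rep_uniq QR RR (nest_refl Q) QinR).
Qed.

(** Each component has one root, and sending a root to its orbit is injective by [connect_orbit] and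
    onto because every board lies in the nest of a representative. *)
Lemma component_count_orbits (H' : {group 'S_16}) (X : {set 'S_16}) :
  X \subset H4 -> <<X>> = H' ->
  component_count X =
    #|orbit sym_action (setX_group H' [set: 'S_4]%G) @: shidoku|.
Proof.
move=> XH4 genX; set K := setX_group _ _.
pose roots_set := [set P in reps | P \in roots (nest_graph X)].
have -> : component_count X = #|roots_set|.
  by apply: eq_card => P; rewrite in_set andbC.
rewrite -(card_in_imset (f := orbit sym_action K)); last first.
  move=> P Q /setIdP[PR /eqP rP] /setIdP[QR /eqP rQ] PQ.
  rewrite -rP -rQ; apply/rootP; first exact: nest_graph_connect_sym.
  by rewrite (connect_orbit XH4 genX PR QR) -/K PQ orbit_refl.
congr #|pred_of_set _|; apply/eqP; rewrite eqEsubset; apply/andP; split.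
  apply: imsetS; apply/subsetP => P /setIdP[PR _].
  exact: reps_shidoku.
apply/subsetP => O /imsetP[B /rep_exists[P PR BP] ->].
have PP0 := connect_root (nest_graph X) P; set P0 := root _ P in PP0.
have P0R : P0 \in reps by rewrite -(closed_connect (@nest_graph_closed X) PP0).
have /orbit_eqP-> : B \in orbit sym_action K P by apply: nest_sub_orbit.
move: PP0; rewrite (connect_orbit XH4 genX PR P0R) => /orbit_eqP<-.
apply: imset_f; apply/setIdP; split=> //.
by apply: roots_root; apply: nest_graph_connect_sym.
Qed.

(** * The two orbits of the full group *)

(** The moves link A, C, D, E, H, I, J, L to one another and likewise B, F, G, K, and the latter
    four are closed under all three generators. *)
Lemma two_orbits : #|orbit sym_action G4 @: shidoku| = 2%N.
Proof.
have [rH sH tH] : [/\ r \in H4, s \in H4 & t \in H4].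
  by rewrite H4_gen; split;
    [exact: (letter_gen 0) | exact: (letter_gen 1) | exact: (letter_gen 2)].
have [[[/andP[sAI _] /andP[sBG sGB] /andP[sCH _]] [_ _ /andP[sFK sKF]]]
  [[/andP[tAC _] /andP[tIE _] /andP[tHD _] /andP[tJL _]] [/andP[tFG tGF] tBB tKK]]
  [_ [[_ rDJ _ _] [/andP[rFG rGF] rBB rKK]]]] := generator_moves.
have oE x P Q : x \in H4 -> maps_to x P Q ->
    orbit sym_action G4 P = orbit sym_action G4 Q.
  by move=> xH PQ; apply/esym/orbit_eqP; apply: maps_to_orbit PQ.
have ->: orbit sym_action G4 @: shidoku =
    [set orbit sym_action G4 board_A; orbit sym_action G4 board_B].
  apply/eqP; rewrite eqEsubset; apply/andP; split; last first.
    apply/subsetP => O; rewrite !in_setU !in_set1.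
    by case/orP=> /eqP->; apply: imset_f; apply: reps_shidoku;
      rewrite in_set !in_cons eqxx ?orbT.
  apply/subsetP => O /imsetP[B /rep_exists[P PR BP] ->].
  have /orbit_eqP-> : B \in orbit sym_action G4 P by apply: nest_sub_orbit.
  (* These equalities form two spanning trees, containing A and B respectively. *)
  have eI := oE _ _ _ sH sAI; have eC := oE _ _ _ tH tAC.
  have eE := oE _ _ _ tH tIE; have eH := oE _ _ _ sH sCH.
  have eD := oE _ _ _ tH tHD; have eJ := oE _ _ _ rH rDJ.
  have eL := oE _ _ _ tH tJL; have eG := oE _ _ _ sH sBG.
  have eF := oE _ _ _ tH tFG; have eK := oE _ _ _ sH sFK.
  rewrite in_set2; move: PR; rewrite in_set !in_cons in_nil orbF.
  repeat case/orP; move=> /eqP->;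
    rewrite -?eL -?eJ -?eD -?eH -?eE -?eI -?eC -?eK ?eF -?eG ?eqxx ?orbT //.
rewrite cards2; case: eqP => // AB; exfalso.
pose D := [set P in [:: board_B; board_F; board_G; board_K]].
have Dreps : D \subset reps.
  apply/subsetP => P; rewrite !in_set !in_cons in_nil orbF.
  by case/or4P=> /eqP->; rewrite eqxx ?orbT.
have AinB : board_A \in orbit sym_action G4 board_B by rewrite -AB orbit_refl.
have BD : board_B \in D by rewrite in_set mem_head.
have genH4 : <<[set r; s; t]>> = H4 by rewrite H4_gen.
have gensH : [set r; s; t] \subset H4 by rewrite H4_gen subset_gen.
have [x P Q xX PD QR PQ|Q QD AQ] := orbit_closed gensH genH4 Dreps _ BD AinB.
  (* A moved board has only one representative, so exhibiting one inside [D] is enough. *)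
  suff [Q' Q'D PQ'] : exists2 Q', Q' \in D & maps_to x P Q'.
    by rewrite (rep_uniq QR (subsetP Dreps _ Q'D) PQ PQ').
  have [mB mF mG mK] : [/\ board_B \in D, board_F \in D, board_G \in D & board_K \in D].
    by rewrite !in_set !in_cons !eqxx !orbT.
  move: xX PD; rewrite !in_setU !in_set1 [_ \in D]in_set !in_cons in_nil orbF.
  move=> /orP[/orP[]|] /eqP-> /or4P[] /eqP->;
    by [exists board_B | exists board_F | exists board_G | exists board_K].
have AR : board_A \in reps by rewrite in_set !in_cons eqxx.
have AQeq := rep_uniq AR (subsetP Dreps _ QD) (nest_refl _) AQ.
(* Positions 1, 5, 6, 10 hold the digits of B, F, G, K; comparing digit lists is a computation. *)
pose ds := [seq nth [::] rep_digits i | i <- [:: 1; 5; 6; 10]%N].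
have /mapP[e e_ds Ae] : board_A \in map board_of ds.
  by rewrite AQeq; move: QD; rewrite in_set.
have e_reps : e \in rep_digits by move: e e_ds {Ae}; apply/allP.
have dAe := @board_of_inj (nth [::] rep_digits 0%N) e isT e_reps Ae.
by move: e_ds; rewrite -dAe.
Qed.

(** * The criterion for complete symmetry groups *)

Theorem theorem2 :
  [/\ (* every S_4-orbit on Shidoku boards contains exactly one of A - L *)
      #|reps| = 12%N /\ is_transversal reps nests shidoku,
      H4 = <<[set r; s; t]>> :> {set 'S_16},
      [/\ [/\ swaps s board_A board_I, swaps s board_B board_G
            & swaps s board_C board_H] /\
          [/\ swaps s board_D board_L, swaps s board_E board_J
            & swaps s board_F board_K],
          [/\ swaps t board_A board_C, swaps t board_I board_E,
              swaps t board_H board_D & swaps t board_J board_L] /\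
          [/\ swaps t board_F board_G, maps_to t board_B board_B
            & maps_to t board_K board_K]
        & [/\ swaps r board_A board_E & swaps r board_I board_C] /\
          [/\ maps_to r board_H board_D, maps_to r board_D board_J,
              maps_to r board_J board_L & maps_to r board_L board_H] /\
          [/\ swaps r board_F board_G, maps_to r board_B board_B
            & maps_to r board_K board_K]]
    & forall (H' : {group 'S_16}) (X : {set 'S_16}),
        H' \subset H4 -> <<X>> = H' ->
        complete_symmetry_group (setX_group H' [set: 'S_4]%G)
          <-> component_count X = 2%N].
Proof.
split; [by split; [apply: card_reps | apply: reps_transversal] | exact: H4_gen
  | exact: generator_moves |].
move=> H' X H'H4 genX.
have XH4 : X \subset H4 by apply: subset_trans H'H4; rewrite -genX subset_gen.
rewrite (component_count_orbits XH4 genX); set K := setX_group _ _.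
have KG : K \subset G4 by apply: setXS.
split=> [[_ ->]|card2]; first exact: two_orbits.
(* [merge] sends each orbit of [K] to the orbit of [G4] containing it. It is a surjection between
   two sets of size two, hence injective. *)
split=> //; pose merge (O : {set board}) := \bigcup_(B in O) orbit sym_action G4 B.
have mergeE B : merge (orbit sym_action K B) = orbit sym_action G4 B.
  apply/eqP; rewrite eqEsubset; apply/andP; split.
    apply/bigcupsP => B' /(subsetP (imsetS _ KG)) /orbit_eqP-> //.
  by apply: (bigcup_sup B); rewrite ?orbit_refl.
have merge_im :
    merge @: (orbit sym_action K @: shidoku) = orbit sym_action G4 @: shidoku.
  by rewrite -imset_comp; apply: eq_imset => B; apply: mergeE.
have /imset_injP merge_inj : #|merge @: (orbit sym_action K @: shidoku)| ==
    #|orbit sym_action K @: shidoku| by rewrite merge_im two_orbits card2.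
apply: eq_in_imset => B Bsh; apply/setP => B'; apply/idP/idP.
  exact: subsetP (imsetS _ KG) B'.
move=> B'B; have B'sh : B' \in shidoku.
  case/orbitP: B'B => [[x sg]]; rewrite in_setX => /andP[xH _] <-.
  by apply: relabel_shidoku; rewrite pos_act_shidoku.
apply/orbit_eqP; apply: merge_inj; rewrite ?imset_f // !mergeE.
exact/orbit_eqP.
Qed.
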